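(* Let $k\geq 1$ be an integer and let $G$ be a balanced bipartite graph of order $2n$, where $n\geq k^3+2k+4$. If $\delta(G)\geq k$ and $\lambda(G)\geq \sqrt{n(n-k)}$, then $G$ is Hamiltonian unless $G=B^k_n$.
   Context: All graphs are finite and simple. $\lambda(G)$ denotes the spectral radius (largest eigenvalue) of the adjacency matrix of $G$, and $\delta(G)$ its minimum degree. A graph is Hamiltonian if it contains a cycle through all its vertices. A bipartite graph is balanced if its two parts have the same size. For $n\geq 2k+1$, $B^k_n$ denotes the graph obtained from the complete bipartite graph $K_{n,n}$ by deleting the edges of a complete bipartite subgraph $K_{k,n-k}$ (with $k$ vertices in one part of $K_{n,n}$ and $n-k$ vertices in the other part). *)

(* Defs.v *)
From mathcomp Require Import all_boot all_order all_algebra.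
From mathcomp Require Import classical_sets reals.

Set Implicit Arguments.
Unset Strict Implicit.
Unset Printing Implicit Defensive.

(* A finite simple graph is a symmetric and irreflexive relation [e : rel T]
   on a finite type [T] of vertices. *)

Definition simple_graph (T : finType) (e : rel T) : Prop :=
  symmetric e /\ irreflexive e.

Definition graph_iso (T1 T2 : finType) (e1 : rel T1) (e2 : rel T2) : Prop :=
  exists2 f : T1 -> T2, bijective f & forall x y, e2 (f x) (f y) = e1 x y.

Definition degree (T : finType) (e : rel T) (x : T) : nat := #|[set y | e x y]|.

(* The default [#|T|] exceeds every degree, so it only matters when [T] is
   empty. *)
Definition min_degree (T : finType) (e : rel T) : nat :=
  \big[minn/#|T|]_(x : T) degree e x.

Definition balanced_bipartite (T : finType) (e : rel T) : Prop :=
  exists X Y : {set T},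
    [/\ X :|: Y = [set: T]%SET, [disjoint X & Y], #|X| = #|Y| &
        forall x y, e x y ->
          ((x \in X) && (y \in Y)) || ((x \in Y) && (y \in X))].

(* The bound on [size c] is needed because [ucycle] accepts an edge traversed
   back and forth, as well as the empty sequence. *)
Definition hamiltonian (T : finType) (e : rel T) : Prop :=
  exists c : seq T, [/\ 2 < size c, ucycle e c & forall x, x \in c].

Definition adjmx (R : realType) (T : finType) (e : rel T) : 'M[R]_#|T| :=
  (\matrix_(i, j) (e (enum_val i) (enum_val j))%:R)%R.

(* The set of eigenvalues is finite, and nonempty when [T] is because the
   matrix is real symmetric; its supremum is then its largest element. *)
Definition spectral_radius (R : realType) (T : finType) (e : rel T) : R :=
  sup [set a : R | eigenvalue (adjmx R e) a]%classic.

Definition complete_bipartite (m n : nat) : rel ('I_m + 'I_n) :=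
  fun u v => match u, v with
    | inl _, inr _ | inr _, inl _ => true
    | _, _ => false
    end.

(* The deleted [K_{k,n-k}] joins the vertices [i < k] of the left part to the
   vertices [j >= k] of the right part. *)
Definition deleted_edge (k n : nat) : rel ('I_n + 'I_n) :=
  fun u v => match u, v with
    | inl i, inr j | inr j, inl i => (i < k) && (k <= j)
    | _, _ => false
    end.

Definition B_graph (k n : nat) : rel ('I_n + 'I_n) :=
  fun u v => complete_bipartite u v && ~~ deleted_edge k u v.

(* Main.v *)
Require Import Defs.
From mathcomp Require Import all_boot all_order all_algebra.
From mathcomp Require Import classical_sets reals.
From mathcomp Require Import zify ring lra.
From mathcomp Require Import fintype finset.

Set Implicit Arguments.
Unset Strict Implicit.
Unset Printing Implicit Defensive.

(** For a bipartite graph, [lambda ^ 2] is at most the number of edges, so that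
    at most [k n] edges of [K_{n,n}] are missing.  Adding an edge between two
    nonadjacent vertices (in different parts) of degree sum larger than [n]
    preserves non-hamiltonicity (Bondy-Chvatal), so assume there is no such
    pair left.  If the graph is not complete bipartite, a nonadjacent pair of
    maximal degree sum produces many vertices of small degree, and counting the
    missing edges leaves only [B^k_n].  Hence a non-Hamiltonian [G] is a
    subgraph of [B^k_n].  If it is a proper one, the minimum degree forces a
    missing edge outside the [k] vertices of degree [k]; splitting a test vector
    on the other part into its mean and its deviation then gives
    [lambda ^ 2 < n (n - k)]. *)

(** * Bipartite graphs and Hamiltonian cycles *)

Definition bipartition (T : finType) (e : rel T) (n : nat) (X : {set T}) :=
  [/\ #|X| = n, #|~: X| = n & forall u v, e u v -> (u \in X) != (v \in X)].

Definition add_edge (T : finType) (e : rel T) (x y : T) : rel T :=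
  fun u v => [|| e u v, (u == x) && (v == y) | (u == y) && (v == x)].

Lemma bipartitionC (T : finType) (e : rel T) (n : nat) (X : {set T}) :
  bipartition e n X -> bipartition e n (~: X).
Proof.
case=> cX cY eX; split=> //; first by rewrite setCK.
by move=> u v /eX; rewrite !inE; case: (u \in X); case: (v \in X).
Qed.

Lemma next_last (T : eqType) (x z : T) (p1 p2 : seq T) :
  uniq (x :: p1 ++ z :: p2) -> next (x :: p1 ++ z :: p2) (last x p1) = z.
Proof.
rewrite -cat_cons => Up; rewrite next_nth mem_cat mem_last orTb.
rewrite index_cat mem_last index_last /= ?nth_cat ?ltnn ?subnn //.
by move: Up; rewrite cat_uniq => /andP[].
Qed.

(* Among the predecessors of the neighbours of [x] along the path, one is a
   neighbour [w] of the other end: reversing the part of the path after [w]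
   closes it. *)
Lemma hamiltonian_path_close (T : finType) (e : rel T) (n : nat) (X : {set T})
    (x : T) (p : seq T) :
  symmetric e -> irreflexive e -> bipartition e n X ->
  path e x p -> uniq (x :: p) -> (forall z, z \in x :: p) -> 1 < size p ->
  (x \in X) != (last x p \in X) -> n < degree e x + degree e (last x p) ->
  hamiltonian e.
Proof.
move=> esym eirr bipX xp Up allp sp xy; set y := last x p in xy * => dxy.
wlog xX : X bipX xy / x \in X => [hw|].
  case xX : (x \in X); first exact: (hw X).
  apply: (hw (~: X)); rewrite ?inE ?xX //; first exact: bipartitionC.
  by move: xy; rewrite xX; case: (_ \in _).
have yX : y \notin X by move: xy; rewrite xX; case: (_ \in _).
case: bipX => cX cY eX.
have edge_prev z : z != x -> e (prev (x :: p) z) z.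
  move=> zx; have : z \in p by have := allp z; rewrite inE (negPf zx).
  move=> zp; case: (splitPr zp) xp Up => p1 p2.
  rewrite cat_path => /andP[_ /andP[wz _]] Up.
  have Uc : uniq (x :: p1 ++ z :: p2) := Up.
  by have := prev_next Uc (last x p1); rewrite (next_last Uc) => ->.
have inj : injective (prev (x :: p)).
  by move=> a b /(congr1 (next (x :: p))); rewrite !next_prev.
pose A := prev (x :: p) @: [set z | e x z].
pose B := [set w | e y w].
(* [A] and [B] both lie in [X], which has [n] elements, while their sizes add up to more than
   [n]. *)
have : 0 < #|A :&: B|.
  rewrite -(ltn_add2l #|A :|: B|) addn0 cardsUI /A card_imset //.
  rewrite (leq_trans _ dxy) // ltnS -cX subset_leq_card //.
  apply/subsetP => w; rewrite inE => /orP[/imsetP[z]|]; rewrite inE.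
    move=> xz ->; have zx : z != x by apply: contraTneq xz => ->; rewrite eirr.
    have := eX _ _ (edge_prev z zx); have := eX _ _ xz; rewrite xX.
    by case: (z \in X); case: (_ \in X).
  by move/eX; rewrite (negPf yX); case: (w \in X).
case/card_gt0P => w; rewrite inE => /andP[/imsetP[z]]; rewrite !inE => xz wE yw.
have zx : z != x by apply: contraTneq xz => ->; rewrite eirr.
have zp : z \in p by have := allp z; rewrite inE (negPf zx).
have nw : next (x :: p) w = z by rewrite wE next_prev.
case: (splitPr zp) @y yX yw nw xp Up allp sp {A B inj edge_prev wE xy dxy} => p1 p2 y yX yw nw.
rewrite cat_path => /andP[xp1 /andP[wz zp2]] Uc allp sp.
have {nw} wE : w = last x p1.
  by rewrite -[LHS](prev_next Uc) nw -[RHS](prev_next Uc) (next_last Uc).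
subst w.
have yE : y = last z p2 by rewrite /y last_cat.
(* From [x] to [w], across to [y], back along the reversed segment to [z], and home by the edge
   between [z] and [x]. *)
exists (x :: p1 ++ rev (z :: p2)).
have pe : perm_eq (x :: p1 ++ rev (z :: p2)) (x :: p1 ++ z :: p2).
  by rewrite perm_cons perm_cat2l perm_rev.
split.
- by rewrite (perm_size pe).
- rewrite /ucycle (perm_uniq pe) Uc andbT.
  rewrite /= rcons_cat cat_path xp1 /=.
  rewrite -rev_cons -(belast_rcons x _ (last x p1)).
  rewrite -{1}(last_rcons x (z :: p2) (last x p1)) rev_path /= esym xz rcons_path.
  by rewrite -yE (esym _ y) yw andbT (eq_path (e' := e)).
- by move=> t; rewrite (perm_mem pe).
Qed.

(** A Hamiltonian cycle that uses the new edge becomes, once that edge is removed, a Hamiltonian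
    path of [e] joining [x] and [y]; the degree condition closes it again. *)
Lemma hamiltonian_add_edge (T : finType) (e : rel T) (n : nat) (X : {set T})
    (x y : T) :
  symmetric e -> irreflexive e -> bipartition e n X ->
  (x \in X) != (y \in X) -> n < degree e x + degree e y ->
  hamiltonian (add_edge e x y) -> hamiltonian e.
Proof.
move=> esym eirr bipX xy dxy [c [sc /andP[cc Uc] allc]].
have [/forallP ce | /forallPn[u nu]] := boolP [forall u, e u (next c u)].
  by exists c; split=> //; rewrite /ucycle Uc andbT cycle_from_next.
pose v := next c u.
have uvxy : (u == x) && (v == y) || (u == y) && (v == x).
  by have := next_cycle cc (allc u); rewrite /add_edge (negPf nu).
have [i p pE] := rot_to (allc v).
have Up : uniq (v :: p) by rewrite -pE rot_uniq.
have allp z : z \in v :: p by rewrite -pE mem_rot.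
have sp : 1 < size p by move: sc; rewrite -(size_rot i) pE.
have lp : last v p = u.
  apply: (can_inj (prev_next Uc)); rewrite -/v -!(next_rot i Uc) pE.
  by rewrite next_nth mem_last index_last // nth_default.
have vp : path e v p.
  have : path (add_edge e x y) v p.
    by have := cc; rewrite -(rot_cycle i) pE /= rcons_path => /andP[].
  have old a b : ~~ ((a == u) && (b == v)) -> ~~ ((a == v) && (b == u)) ->
      add_edge e x y a b -> e a b.
    rewrite /add_edge; case/orP: uvxy => /andP[/eqP<- /eqP<-];
      by move=> /negPf-> /negPf->; rewrite !orbF.
  (* As [p] has at least two vertices, its last vertex [u] differs from its first vertex [w], so the
     first step is not the new edge; the later steps avoid [v]. *)
  case: p sp lp Up {pE allp} => [|w [|w' p]] // _ lp.
  have uE : u \in w' :: p by rewrite -lp /= mem_last.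
  rewrite cons_uniq => /andP[vp Up] /andP[vw wp].
  have uv : u != v by apply: contraNneq vp => <-; rewrite inE uE orbT.
  have uw : u != w by apply: contraTneq Up => <-; rewrite /= uE.
  have {}wp : path e w (w' :: p).
    apply: (sub_in_path (P := predC1 v)) (wp : path _ _ (_ :: _)) => [a b /= av bv|].
      by apply: old; rewrite ?(negPf av) ?(negPf bv) ?andbF.
    by apply/allP => z zp; apply: contraNneq vp => <-.
  suff evw : e v w by apply/andP.
  by apply: old => //; rewrite ?[v == u]eq_sym ?[w == u]eq_sym ?(negPf uv) ?(negPf uw) ?andbF.
apply: (hamiltonian_path_close esym eirr bipX vp) => //; rewrite lp.
  by case/orP: uvxy => /andP[/eqP-> /eqP->] //; rewrite eq_sym.
by case/orP: uvxy => /andP[/eqP-> /eqP->] //; rewrite addnC.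
Qed.

(** The cycle alternates between enumerations of the two parts. *)
Lemma hamiltonian_complete_bipartite (T : finType) (e : rel T) (n : nat)
    (X : {set T}) :
  1 < n -> symmetric e -> bipartition e n X ->
  (forall u v, u \in X -> v \notin X -> e u v) -> hamiltonian e.
Proof.
move=> n1 esym [cX cY _] eXY.
pose c := flatten [seq [:: uv.1; uv.2] | uv <- zip (enum X) (enum (~: X))].
have pc (s t : seq T) : size s = size t ->
    perm_eq (flatten [seq [:: uv.1; uv.2] | uv <- zip s t]) (s ++ t).
  elim: s t => [|a s IH] [|b t] //= [st]; rewrite perm_cons.
  rewrite perm_sym perm_catC /= perm_cons perm_catC perm_sym.
  exact: IH.
have {}pc : perm_eq c (enum X ++ enum (~: X)) by rewrite pc // -!cardE cX.
have alt (a : T) (s t : seq T) : all (mem X) s -> all (mem (~: X)) t ->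
    a \notin X -> size s = size t ->
    let c' := flatten [seq [:: uv.1; uv.2] | uv <- zip s t] in
    path e a c' && (last a c' \notin X).
  elim: s a t => [|u s IH] a [|v t] //=.
  rewrite inE => /andP[uX sX] /andP[vX tX] aX [st].
  by rewrite esym !eXY //=; apply: IH.
have [y yY] : exists y, y \in ~: X by apply/card_gt0P; rewrite cY ltnW.
have memc z : z \in c.
  by rewrite (perm_mem pc) mem_cat !mem_enum inE orbN.
exists c; split=> //.
  by rewrite (perm_size pc) size_cat -!cardE cX cY; lia.
rewrite /ucycle (perm_uniq pc) cat_uniq !enum_uniq andbT /=; apply/andP; split.
  have sX : all (mem X) (enum X) by apply/allP => z; rewrite mem_enum.
  have sY : all (mem (~: X)) (enum (~: X)) by apply/allP => z; rewrite mem_enum.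
  have sXY : size (enum X) = size (enum (~: X)) by rewrite -!cardE cX.
  have yX : y \notin X by rewrite inE in yY.
  (* A cycle is a path started at its own last vertex. A first use of [alt], from [y], places that
     last vertex outside [X]; a second one starts from it. *)
  rewrite (cycle_path y); have /andP[_ lc] := alt y _ _ sX sY yX sXY.
  by have /andP[] := alt _ _ _ sX sY lc sXY.
by apply/hasPn => z; rewrite !mem_enum inE.
Qed.

(** * Degree counting and the structure of closed graphs *)

Lemma degree_bipartite_le (T : finType) (e : rel T) (n : nat) (X : {set T}) (u : T) :
  bipartition e n X -> degree e u <= n.
Proof.
case=> cX cY eX; have [uX|uX] := boolP (u \in X).
  rewrite -cY subset_leq_card //; apply/subsetP => v; rewrite !inE => /eX.
  by rewrite uX; case: (v \in X).
rewrite -cX subset_leq_card //; apply/subsetP => v; rewrite !inE => /eX.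
by rewrite (negPf uX); case: (v \in X).
Qed.

Lemma sum_degreeC (T : finType) (e : rel T) (n : nat) (X : {set T}) :
  symmetric e -> bipartition e n X ->
  \sum_(u in ~: X) degree e u = \sum_(u in X) degree e u.
Proof.
move=> esym [_ _ eX].
have degE u : degree e u = \sum_v e u v.
  by rewrite /degree -sum1dep_card big_mkcond; apply: eq_bigr => v _; case: (e u v).
under eq_bigr do rewrite degE; rewrite exchange_big /=.
rewrite (bigID (mem X)) /= [X in _ + X]big1 ?addn0 => [|v vX].
  apply: eq_bigr => v vX; rewrite degE [RHS](bigID (mem X)) /= [X in _ = X + _]big1 => [|u uX].
    by rewrite add0n; apply: eq_big => u; rewrite ?inE // esym.
  by case euv: (e v u) => //; have := eX _ _ euv; rewrite vX uX.
apply: big1 => u; rewrite inE => uX.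
by case euv: (e u v) => //; have := eX _ _ euv; rewrite (negPf vX) (negPf uX).
Qed.

(* [e] is a subgraph of [B^k_n], the deleted [K_{k,n-k}] joining [S] to the
   complement of [Y1] in the part opposite to [X]. *)
Definition in_B_graph (T : finType) (e : rel T) (k : nat) (X S Y1 : {set T}) :=
  [/\ S \subset X, Y1 \subset ~: X, #|S| = k, #|Y1| = k &
      forall u v, u \in S -> e u v -> v \in Y1].

(** By extremality the nonneighbours [S] of [y] in [X] have degree at most that of [x], and there
    are at least [degree e x] of them. Since at most [n * k] edges are missing, this forces
    [degree e x = k] and then [#|S| = k]. The set [S] accounts for [k * (n - k)] missing edges,
    which leaves at most [k ^ 2] for the rest of [X]. *)
Lemma closed_in_B_graph (T : finType) (e : rel T) (n k : nat) (X : {set T})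
    (x y : T) :
  symmetric e -> bipartition e n X -> k ^ 3 + 2 * k + 4 <= n ->
  (forall v, k <= degree e v) -> n * (n - k) <= \sum_(u in X) degree e u ->
  (forall u v, u \in X -> v \notin X -> ~~ e u v -> degree e u + degree e v <= n) ->
  (forall u v, u \in X -> v \notin X -> ~~ e u v ->
    degree e u + degree e v <= degree e x + degree e y) ->
  x \in X -> y \notin X -> ~~ e x y -> degree e x <= degree e y ->
  exists S Y1, in_B_graph e k X S Y1.
Proof.
move=> esym bipX kn degk edges closed extr xX yX nxy dxy.
(* [kn1] will exclude [degree e x > k]; [kn2] will exclude missing edges at [X :\: S]. *)
have [kn1 kn2] : (k + 1) * (k + 1) < n /\ 2 * k ^ 2 + k < n.
  have : k ^ 2 <= k ^ 3 by case: (posnP k) => [->//|k0]; rewrite leq_pexp2l.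
  have : 2 * k ^ 2 <= k ^ 3 + k.
    case: {kn degk edges closed}k => // m; rewrite (expnS _ 2) -mulnn; nia.
  rewrite !mulnDl !mulnDr mulnn; lia.
have degn u := degree_bipartite_le u bipX; case: (bipX) => cX cY eX.
pose S := [set u in X | ~~ e u y].
have SX : S \subset X by apply/subsetP => u; rewrite inE => /andP[].
have cS : #|S| = n - degree e y.
  have Ny : [set u | e y u] \subset X.
    by apply/subsetP => u; rewrite inE => /eX; rewrite (negPf yX); case: (u \in X).
  have -> : S = X :\: [set u | e y u].
    by apply/setP => u; rewrite !inE andbC esym.
  by rewrite cardsD (setIidPr Ny) cX.
have degS u : u \in S -> degree e u <= degree e x.
  by rewrite inE => /andP[uX nuy]; have := extr u y uX yX nuy; rewrite leq_add2r.
have defect : \sum_(u in X) (n - degree e u) <= n * k.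
  suff : \sum_(u in X) (n - degree e u) + \sum_(u in X) degree e u = n * n.
    by rewrite mulnBr in edges; lia.
  by rewrite -big_split /= (eq_bigr (fun=> n)) ?sum_nat_const ?cX // => u _; rewrite subnK.
have defectS : #|S| * (n - degree e x) <= \sum_(u in S) (n - degree e u).
  rewrite -sum_nat_const; apply: leq_sum => u /degS; lia.
have defectD : \sum_(u in X) (n - degree e u) =
    \sum_(u in S) (n - degree e u) + \sum_(u in X :\: S) (n - degree e u).
  by rewrite (big_setID S) /= (setIidPr SX).
have dxyn := closed x y xX yX nxy.
have dxk : degree e x = k.
  have dyn := degn y; have := degk x; rewrite leq_eqVlt => /orP[/eqP<- //|xk].
  move: defectS defect; rewrite cS defectD => d1 d2.
  have : (n - degree e y) * (n - degree e x) <= n * k by lia.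
  move: dxy dxyn dyn xk; move: (degree e x) (degree e y) => i j *.
  (* By concavity, [i * (n - i)] on the range from [k + 1] to [n - (k + 1)] is least at the ends. *)
  have : (k + 1) * (n - (k + 1)) <= (n - j) * (n - i).
    have [[a iE] [b jE]] : (exists a, i = k + 1 + a) /\ (exists b, n - i = k + 1 + b).
      by split; [exists (i - (k + 1)) | exists (n - i - (k + 1))]; lia.
    apply: (@leq_trans (i * (n - i))); last by rewrite leq_mul2r; lia.
    have -> : n - (k + 1) = k + 1 + a + b by lia.
    by rewrite jE iE !mulnDl !mulnDr; lia.
  rewrite mulnBr mulnDl mul1n mulnC; lia.
have cSk : #|S| = k.
  apply/eqP; rewrite eqn_leq; apply/andP; split; last by rewrite cS -dxk; lia.
  rewrite leqNgt; apply/negP => cSk.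
  have : (k + 1) * (n - k) <= n * k.
    apply: leq_trans defect; rewrite defectD -{2}dxk.
    apply: leq_trans (leq_addr _ _); apply: leq_trans defectS.
    by rewrite leq_mul2r addn1 cSk orbT.
  rewrite mulnBr mulnDl mul1n [k * n]mulnC mulnDl mul1n; lia.
have degSk u : u \in S -> degree e u = k.
  by move=> /degS du; apply/eqP; rewrite eqn_leq degk -{1}dxk du.
have defectX2 : \sum_(u in X :\: S) (n - degree e u) <= k ^ 2.
  move: defectS defect; rewrite defectD cSk dxk mulnBr -mulnn [n * k]mulnC.
  have : k * k <= k * n by rewrite leq_mul2l; lia.
  lia.
(* If [u] and [v] were nonadjacent, [u] would have degree at least [n - k ^ 2], hence [v] at most
   [k ^ 2]. But at most [k ^ 2] vertices of [X :\: S] miss [v], so [n - k <= 2 * k ^ 2]. *)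
have X2full u v : u \in X :\: S -> v \notin X -> e u v.
  move=> uX2 vX; apply/negPn/negP => nuv.
  have uX : u \in X by move: uX2; rewrite inE => /andP[].
  have du : n - degree e u <= k ^ 2.
    by apply: leq_trans defectX2; rewrite (bigD1 u) //= leq_addr.
  have dv := closed u v uX vX nuv.
  have : #|(X :\: S) :\: [set w | e v w]| <= k ^ 2.
    apply: leq_trans defectX2; rewrite -sum1_card [leqRHS](big_setID [set w | e v w]) /=.
    rewrite (leq_trans _ (leq_addl _ _)) // leq_sum // => w; rewrite !inE => /and3P[nvw _ wX].
    rewrite subn_gt0 -cY proper_card //; apply/properP; split.
      apply/subsetP => z; rewrite !inE => /eX; rewrite wX; by case: (z \in X).
    by exists v; rewrite !inE // esym.
  rewrite !cardsD (setIidPr SX) cX cSk.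
  have : #|(X :\: S) :&: [set w | e v w]| <= degree e v by rewrite subset_leq_card ?subsetIr.
  lia.
have xS : x \in S by rewrite inE xX.
exists S, [set v | e x v]; split=> //.
- by apply/subsetP => v; rewrite !inE => /eX; rewrite xX; case: (v \in X).
- move=> u v uS; suff -> : [set v | e x v] = [set v | e u v] by rewrite inE.
  apply/eqP; rewrite eqEcard; apply/andP; split; last first.
    by rewrite -/(degree e x) -/(degree e u) dxk degSk.
  apply/subsetP => w; rewrite !inE => xw; apply/negPn/negP => nuw.
  have uX := subsetP SX u uS.
  have wX : w \notin X by have := eX _ _ xw; rewrite xX; case: (w \in X).
  have := closed u w uX wX nuw; rewrite degSk //.
  (* [w] is adjacent to [x] and to all of [X :\: S], so its degree is at least [n - k + 1], too much
     for a nonneighbour of [u]. *)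
  have : #|x |: (X :\: S)| <= degree e w.
    apply: subset_leq_card; apply/subsetP => z /setU1P[->|zX2]; rewrite inE esym //.
    exact: X2full.
  rewrite cardsU1 !inE xX nxy /= cardsD (setIidPr SX) cX cSk.
  lia.
Qed.

Lemma sub_bipartition (T : finType) (e e' : rel T) (n : nat) (X : {set T}) :
  subrel e e' -> bipartition e' n X -> bipartition e n X.
Proof. by move=> sub [cX cY eX]; split=> // u v /sub/eX. Qed.

Lemma sub_degree (T : finType) (e e' : rel T) (u : T) :
  subrel e e' -> degree e u <= degree e' u.
Proof.
by move=> sub; apply: subset_leq_card; apply/subsetP => v; rewrite !inE => /sub.
Qed.

(* Adding an edge between two nonadjacent vertices of degree sum exceeding [n]
   does not affect hamiltonicity, so that one may assume that there are none. *)
Lemma hamiltonian_or_in_B_graph (T : finType) (e : rel T) (n k : nat) (X : {set T}) :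
  symmetric e -> irreflexive e -> bipartition e n X -> k ^ 3 + 2 * k + 4 <= n ->
  (forall v, k <= degree e v) -> n * (n - k) <= \sum_(u in X) degree e u ->
  hamiltonian e \/
  exists X' S Y1, bipartition e n X' /\ in_B_graph e k X' S Y1.
Proof.
move=> + + + kn.
(* Induction on the number of ordered nonadjacent pairs. *)
have [m] := ubnP #|[set uv : T * T | ~~ e uv.1 uv.2]|.
elim: m e => // m IH e em esym eirr bipX degk edges.
have [cX cY eX] := bipX.
pose nonedge (uv : T * T) := [&& uv.1 \in X, uv.2 \notin X & ~~ e uv.1 uv.2].
pose dsum (uv : T * T) := degree e uv.1 + degree e uv.2.
have [/existsP[[x y] /= /andP[/and3P[/= xX yX nxy] dxy]]|] :=
    boolP [exists uv, nonedge uv && (n < dsum uv)].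
  have sub : subrel e (add_edge e x y) by move=> u v uv; rewrite /add_edge uv.
  have [] := IH (add_edge e x y).
  - rewrite -ltnS (leq_trans _ em) // ltnS proper_card //; apply/properP; split.
      by apply/subsetP => -[u v]; rewrite !inE; apply: contra; apply: sub.
    by exists (x, y); rewrite !inE //= /add_edge !eqxx orbT.
  - by move=> u v; rewrite /add_edge esym; congr (_ || _); rewrite orbC ![_ && (u == _)]andbC.
  - move=> u; rewrite /add_edge eirr /=; apply/negP.
    by move=> /orP[] /andP[/eqP-> /eqP xy]; move: yX; rewrite -?xy ?xX // xy xX.
  - split=> // u v /orP[/eX//|/orP[]/andP[/eqP-> /eqP->]]; rewrite xX (negPf yX) //.
  - by move=> v; apply: leq_trans (degk v) (sub_degree _ sub).
  - by apply: leq_trans edges _; apply: leq_sum => u _; apply: sub_degree.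
  - move=> ham; left; apply: hamiltonian_add_edge bipX _ dxy ham => //.
    by rewrite xX (negPf yX).
  - move=> [X' [S [Y1 [bipX' [SX YX cS cY1 SY]]]]]; right; exists X', S, Y1.
    split; first exact: sub_bipartition bipX'.
    by split=> // u v uS /sub; apply: SY.
move=> /existsPn closed.
have [/existsP[uv0 uv0P] | /existsPn complete] := boolP [exists uv, nonedge uv]; last first.
  left; apply: (hamiltonian_complete_bipartite _ esym bipX) => [|u v uX vX]; first by lia.
  by have := complete (u, v); rewrite /nonedge /= uX vX /= negbK.
case: (arg_maxnP dsum uv0P) => -[x y] /and3P[/= xX yX nxy] extr.
have closed' u v : u \in X -> v \notin X -> ~~ e u v -> degree e u + degree e v <= n.
  move=> uX vX nuv; have := closed (u, v).
  by rewrite /nonedge /= uX vX nuv /= -leqNgt.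
have extr' u v : u \in X -> v \notin X -> ~~ e u v ->
    degree e u + degree e v <= degree e x + degree e y.
  by move=> uX vX nuv; apply: (extr (u, v)); rewrite /nonedge /= uX vX.
(* The vertex of smaller degree has to lie in the distinguished part, so the parts may have to be
   exchanged. *)
right; case: (leqP (degree e x) (degree e y)) => dxy.
  exists X; have [S [Y1 SY1]] :=
    closed_in_B_graph esym bipX kn degk edges closed' extr' xX yX nxy dxy.
  by exists S, Y1.
exists (~: X); have bipY := bipartitionC bipX.
have [|||||||S [Y1 SY1]] := @closed_in_B_graph _ e n k (~: X) y x esym bipY kn degk.
- by rewrite (sum_degreeC esym bipX).
- by move=> u v; rewrite !inE negbK esym addnC => *; apply: closed'.
- by move=> u v; rewrite !inE negbK esym addnC [leqRHS]addnC => *; apply: extr'.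
- by rewrite inE.
- by rewrite inE negbK.
- by rewrite esym.
- exact: ltnW.
by exists S, Y1.
Qed.

(** * Eigenvector estimates *)

Import Order.TTheory GRing.Theory Num.Theory.
Local Open Scope ring_scope.

(** Cauchy-Schwarz against a constant vector, from the nonnegativity of the sum of the squares of
    [#|A| * g i - S]. *)
Lemma sqr_sum_le_card (R : realFieldType) (T : finType) (A : {set T}) (g : T -> R) :
  (\sum_(i in A) g i) ^+ 2 <= #|A|%:R * \sum_(i in A) g i ^+ 2.
Proof.
have [-> | A0] := eqVneq A set0; first by rewrite !big_set0 mulr0 expr0n.
have c0 : 0 < #|A|%:R :> R by rewrite ltr0n card_gt0.
set S := \sum_(i in A) g i.
have : 0 <= \sum_(i in A) (#|A|%:R * g i - S) ^+ 2 by apply: sumr_ge0 => i _; exact: sqr_ge0.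
rewrite (eq_bigr (fun i => #|A|%:R ^+ 2 * g i ^+ 2 + (- (2 * #|A|%:R * S) * g i + S ^+ 2)));
  last by move=> i _; ring.
rewrite !big_split /= -!mulr_sumr sumr_const -/S -mulr_natl => h.
rewrite -subr_ge0 -(pmulr_rge0 _ c0); lra.
Qed.

(** Taking absolute values of an eigenvector gives a nonnegative [g] without Perron-Frobenius, at
    the cost of turning an equality into an inequality. Nonnegativity later allows neighbourhoods to
    be enlarged. *)
Lemma eigenvector_test (R : realType) (T : finType) (e : rel T) (n : nat)
    (X : {set T}) (a : R) :
  symmetric e -> bipartition e n X -> 0 < a -> eigenvalue (adjmx R e) a ->
  exists g : T -> R, [/\ forall t, 0 <= g t, 0 < \sum_(y in ~: X) g y ^+ 2 &
    a ^+ 2 * (\sum_(y in ~: X) g y ^+ 2) <=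
      \sum_(x in X) (\sum_(y in [set y | e x y]) g y) ^+ 2].
Proof.
move=> esym [_ _ eX] a0 /eigenvalueP[v vA v0].
pose f t := v ord0 (enum_rank t).
have fE t : \sum_(u in [set u | e t u]) f u = a * f t.
  have := congr1 (fun w : 'rV_#|T| => w ord0 (enum_rank t)) vA.
  rewrite !mxE => <-; rewrite (reindex (@enum_rank T)) /=; last first.
    exact/onW_bij/enum_rank_bij.
  rewrite [RHS](bigID (mem [set u | e t u])) /= [X in _ + X]big1 ?addr0 => [|u].
    apply: eq_bigr => u; rewrite inE => tu.
    by rewrite mxE !enum_rankK esym tu mulr1.
  by rewrite inE mxE !enum_rankK esym => /negPf->; rewrite mulr0.
(* Multiplied by [a], both sides become the sum of [f x * f y] over the edges. *)
have sum_sqr_eq : \sum_(x in X) f x ^+ 2 = \sum_(y in ~: X) f y ^+ 2.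
  apply: (mulfI (lt0r_neq0 a0)); rewrite !mulr_sumr.
  transitivity (\sum_(x in X) \sum_(y in [set y | e x y]) f x * f y).
    by apply: eq_bigr => x _; rewrite -mulr_sumr fE; ring.
  rewrite (exchange_big_dep (mem (~: X))) /= => [|x y xX]; last first.
    by rewrite !inE => /eX; rewrite xX; case: (y \in X).
  apply: eq_bigr => y yX; rewrite inE in yX.
  have -> : a * f y ^+ 2 = (a * f y) * f y by ring.
  rewrite -fE mulr_suml; apply: eq_bigl => x; rewrite !inE esym.
  have [|] := boolP (e y x); rewrite ?andbF ?andbT // => /eX.
  by rewrite (negPf yX); case: (x \in X).
exists (fun t => `|f t|); split=> //.
- rewrite lt0r sumr_ge0 ?andbT => [|y _]; last exact: sqr_ge0.
  under eq_bigr do rewrite real_normK ?num_real //.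
  apply: contra v0 => /eqP Q0.
  have f0 t : f t = 0.
    apply/eqP; rewrite -sqrf_eq0; apply/eqP; have [tX|tX] := boolP (t \in X).
      by apply: (psumr_eq0P _ (etrans sum_sqr_eq Q0)) => // u _; exact: sqr_ge0.
    by apply: (psumr_eq0P _ Q0); rewrite ?inE // => u _; exact: sqr_ge0.
  by apply/eqP/rowP => i; have := f0 (enum_val i); rewrite /f enum_valK mxE.
- under eq_bigr do rewrite real_normK ?num_real //.
  rewrite -sum_sqr_eq mulr_sumr; apply: ler_sum => x _.
  rewrite -exprMn -fE -[X in X <= _]real_normK ?num_real //.
  by rewrite lerXn2r ?nnegrE ?sumr_ge0 // ler_norm_sum.
Qed.

(** Cauchy-Schwarz on each neighbourhood bounds the term of [x] by [degree e x] times the square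
    norm of [g]. *)
Lemma eigenvalue_sqr_le_edges (R : realType) (T : finType) (e : rel T) (n : nat)
    (X : {set T}) (a : R) :
  symmetric e -> bipartition e n X -> 0 < a -> eigenvalue (adjmx R e) a ->
  a ^+ 2 <= (\sum_(x in X) degree e x)%:R.
Proof.
move=> esym bipX a0 aE; have [_ _ eX] := bipX.
have [g [g0 Q0 aQ]] := eigenvector_test esym bipX a0 aE.
rewrite -(ler_pM2r Q0); apply: le_trans aQ _.
rewrite natr_sum mulr_suml; apply: ler_sum => x xX.
apply: le_trans (sqr_sum_le_card _ _) _; rewrite ler_wpM2l ?ler0n //.
rewrite [leRHS](big_setID [set y | e x y]) /= (setIidPr _) ?lerDl ?sumr_ge0 // => [y _|].
  exact: sqr_ge0.
by apply/subsetP => y; rewrite !inE => /eX; rewrite xX; case: (y \in X).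
Qed.

(* [m] is the mean of a test vector, [H], [h] the sum over the [K] vertices and
   the value at one vertex of its deviation from the mean, [V] the square norm
   of that deviation. *)
Lemma test_vector_bound (R : realFieldType) (K N m H h V : R) :
  1 <= K -> K ^+ 3 + 2 * K + 4 <= N -> H ^+ 2 <= K * V -> h ^+ 2 <= V ->
  0 < N * m ^+ 2 + V ->
  K * (K * m + H) ^+ 2 + (N - K - 1) * (N * m) ^+ 2 + (N * m - (m + h)) ^+ 2 <
    N * (N - K) * (N * m ^+ 2 + V).
Proof.
move=> K1 KN HV hV Q0.
have V0 : 0 <= V by apply: le_trans hV; exact: sqr_ge0.
have m0 : 0 <= m ^+ 2 := sqr_ge0 m.
(* [K ^ 3 - 3 * K + 2] factors as [(K - 1) ^ 2 * (K + 2)]. *)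
have N5 : 5 * K + 2 <= N.
  have : 0 <= (K - 1) ^+ 2 * (K + 2) by rewrite mulr_ge0 ?sqr_ge0 //; lra.
  lra.
have t1 : K * (K * m + H) ^+ 2 <= 2 * K ^+ 3 * m ^+ 2 + 2 * K ^+ 2 * V.
  have : 0 <= K * (K * m - H) ^+ 2 by rewrite mulr_ge0 ?sqr_ge0 //; lra.
  have : K * H ^+ 2 <= K * (K * V) by rewrite ler_wpM2l //; lra.
  nra.
(* The cross term is split with weight 10. This leaves the constant 11 in the coefficient of
   [m ^ 2], just below the margin [2 * N - 2 * K ^ 3], which is at least 12. *)
have t2 : (N * m - (m + h)) ^+ 2 <=
    (N ^+ 2 - 2 * N + 11) * m ^+ 2 + (1 + (N - 1) ^+ 2 / 10) * V.
  have : 0 <= (10 * m + (N - 1) * h) ^+ 2 := sqr_ge0 _.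
  have : (1 + (N - 1) ^+ 2 / 10) * h ^+ 2 <= (1 + (N - 1) ^+ 2 / 10) * V.
    by rewrite ler_wpM2l // addr_ge0 // divr_ge0 ?sqr_ge0.
  lra.
have c1 : 2 * K ^+ 3 - 2 * N + 11 < 0 by lra.
have c2 : 2 * K ^+ 2 + 1 + (N - 1) ^+ 2 / 10 < N * (N - K) by nra.
(* Strictness comes from the mean, through [c1], if [V] vanishes, and from the deviation, through
   [c2], otherwise. *)
have [V00|V00] := eqVneq V 0.
  have mp : 0 < m ^+ 2.
    rewrite lt0r m0 andbT; apply: contraTneq Q0 => ->; rewrite V00; lra.
  have := mp; rewrite -(nmulr_rlt0 _ c1); rewrite V00 in t1 t2 *; nra.
have Vp : 0 < V by rewrite lt0r V00.
have : (2 * K ^+ 2 + 1 + (N - 1) ^+ 2 / 10) * V < N * (N - K) * V by rewrite ltr_pM2r.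
have : (2 * K ^+ 3 - 2 * N + 11) * m ^+ 2 <= 0 by rewrite mulr_le0_ge0 // ltW.
lra.
Qed.

Lemma ler_sum_subset (R : numDomainType) (T : finType) (A B : {set T}) (g : T -> R) :
  (forall t, 0 <= g t) -> A \subset B -> \sum_(i in A) g i <= \sum_(i in B) g i.
Proof.
move=> g0 AB; rewrite [leRHS](big_setID A) /= (setIidPr AB) lerDl.
exact: sumr_ge0.
Qed.

Lemma eigenvalue_sqr_lt_in_B_graph (R : realType) (T : finType) (e : rel T)
    (n k : nat) (X S Y1 : {set T}) (x0 y0 : T) (a : R) :
  symmetric e -> bipartition e n X -> in_B_graph e k X S Y1 ->
  (1 <= k)%N -> (k ^ 3 + 2 * k + 4 <= n)%N ->
  x0 \in X :\: S -> y0 \in ~: X -> ~~ e x0 y0 ->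
  0 < a -> eigenvalue (adjmx R e) a ->
  a ^+ 2 < n%:R * (n%:R - k%:R).
Proof.
move=> esym bipX [SX Y1Y cS cY1 SY] k1 kn x0X2 y0Y nxy a0 aE; have [cX cY eX] := bipX.
have [g [g0 Q0 aQ]] := eigenvector_test esym bipX a0 aE.
rewrite -(ltr_pM2r Q0); apply: le_lt_trans aQ _.
set N : R := n%:R; set K : R := k%:R.
have N0 : 0 < N by rewrite ltr0n; lia.
pose s := \sum_(y in ~: X) g y; pose m := s / N.
pose dev (A : {set T}) := \sum_(y in A) (g y - m).
pose V := \sum_(y in ~: X) (g y - m) ^+ 2.
have sE : s = N * m by rewrite mulrC divfK // lt0r_neq0.
have devE (A : {set T}) : \sum_(y in A) g y = #|A|%:R * m + dev A.
  by rewrite /dev sumrB sumr_const -mulr_natl; ring.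
have QE : \sum_(y in ~: X) g y ^+ 2 = N * m ^+ 2 + V.
  rewrite /V [X in _ + X](eq_bigr (fun y => g y ^+ 2 + (- (2 * m) * g y + m ^+ 2)));
    last by move=> y _; ring.
  by rewrite !big_split /= -mulr_sumr -/s sE sumr_const cY -[_ *+ n]mulr_natl -/N; ring.
have devV (A : {set T}) : A \subset ~: X -> dev A ^+ 2 <= #|A|%:R * V.
  move=> AY; apply: le_trans (sqr_sum_le_card _ _) _; rewrite ler_wpM2l ?ler0n //.
  by apply: ler_sum_subset => // t; exact: sqr_ge0.
have sum1E : \sum_(y in Y1) g y = K * m + dev Y1 by rewrite devE cY1.
have g0E : g y0 = m + dev [set y0] by have := devE [set y0]; rewrite cards1 mul1r big_set1.
have sqr_le (A B : {set T}) : A \subset B ->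
    (\sum_(y in A) g y) ^+ 2 <= (\sum_(y in B) g y) ^+ 2.
  by move=> AB; rewrite lerXn2r ?nnegrE ?sumr_ge0 ?ler_sum_subset.
have nbrY x : x \in X -> [set y | e x y] \subset ~: X.
  by move=> xX; apply/subsetP => y; rewrite !inE => /eX; rewrite xX; case: (y \in X).
have x0X : x0 \in X by move: x0X2; rewrite inE => /andP[].
have cX2 : #|(X :\: S) :\ x0|%:R = N - K - 1.
  have : (#|(X :\: S) :\ x0| + 1 + k = n)%N.
    have := cardsD1 x0 (X :\: S); rewrite x0X2 cardsD (setIidPr SX) cX cS; lia.
  by move/(congr1 (fun i : nat => i%:R : R)); rewrite !natrD -/N -/K => <-; ring.
(* The three terms bound the contributions of [S], whose vertices see only [Y1], of the other
   vertices of [X] except [x0], and of [x0], which misses [y0]. *)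
apply: (@le_lt_trans _ _ (K * (K * m + dev Y1) ^+ 2 + (N - K - 1) * (N * m) ^+ 2 +
    (N * m - (m + dev [set y0])) ^+ 2)); last first.
  rewrite QE; apply: test_vector_bound.
  - by rewrite ler1n.
  - by rewrite /K /N -natrX -[2]/(2%:R) -[4]/(4%:R) -natrM -!natrD ler_nat.
  - by rewrite /K -cY1 devV.
  - by have := devV [set y0]; rewrite cards1 mul1r sub1set; apply.
  - by rewrite -QE.
rewrite (big_setID S) /= (setIidPr SX) -addrA; apply: lerD.
  rewrite -sum1E /K -cS mulr_natl -sumr_const; apply: ler_sum => x xS.
  by apply: sqr_le; apply/subsetP => y; rewrite inE; apply: SY.
rewrite (big_setD1 x0) //= addrC; apply: lerD.
  rewrite -cX2 -sE mulr_natl -sumr_const; apply: ler_sum => x.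
  by rewrite !inE => /and3P[_ _ xX]; apply/sqr_le/nbrY.
have -> : N * m - (m + dev [set y0]) = \sum_(y in ~: X :\ y0) g y.
  by rewrite -g0E -sE /s (big_setD1 y0) //= addrC addrK.
apply: sqr_le; apply/subsetP => y; rewrite inE => xy.
rewrite !inE; apply/andP; split; first by apply: contraNneq nxy => <-.
by have := subsetP (nbrY x0 x0X) y; rewrite !inE; apply.
Qed.

(** * From the spectral radius to an eigenvalue *)

Lemma finite_roots (R : idomainType) (p : {poly R}) :
  p != 0 -> exists s : seq R, forall x, root p x -> x \in s.
Proof.
have [m] := ubnP (size p); elim: m p => // m IH p pm p0.
have [[x px]|nr] := boolp.pselect (exists x, root p x); last first.
  by exists [::] => x px; case: nr; exists x.
have [q pE] := factor_theorem _ _ px.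
have q0 : q != 0 by apply: contraNneq p0 => q0; rewrite pE q0 mul0r.
have [|s sP] := IH q _ q0.
  rewrite -ltnS; apply: leq_trans pm.
  by rewrite pE size_Mmonic ?monicXsubC // size_XsubC addn2.
exists (x :: s) => y; rewrite pE rootM root_XsubC inE orbC => /orP[->//|/sP->].
by rewrite orbT.
Qed.

Lemma spectral_radius_ge_eigenvalue (R : realType) (T : finType) (e : rel T) (c : R) :
  0 < c -> c <= spectral_radius R e ->
  exists2 a : R, c <= a & eigenvalue (adjmx R e) a.
Proof.
move=> c0 cle; apply: boolp.contrapT => no.
have small a : eigenvalue (adjmx R e) a -> a < c.
  by move=> aE; rewrite ltNge; apply/negP => ca; apply: no; exists a.
have [s sP] := finite_roots (monic_neq0 (char_poly_monic (adjmx R e))).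
(* The default [0] is below [c], and is also the value of [sup] on the empty set. *)
pose M := \big[Num.max/0]_(a <- s | eigenvalue (adjmx R e) a) a.
have Mc : M < c by apply: bigmax_lt => // a /small.
move: cle; rewrite leNgt => /negP; apply; apply: le_lt_trans Mc.
rewrite /spectral_radius; set E := [set _ | _]%classic.
have [->|/set0P E0] := eqVneq E classical_sets.set0.
  by rewrite sup0 /M bigmax_ge_id.
apply: ge_sup => // a aE; apply: le_bigmax_seq => //.
by apply: sP; rewrite -eigenvalue_root_char.
Qed.

Local Close Scope ring_scope.

(** * Isomorphism with [B_graph] *)

(** [g] is the position in a list of [X] that starts with [A]; it turns [S] and [Y1] into the
    initial segments used by [B_graph]. *)
Lemma index_subset_first (T : finType) (A X : {set T}) (k n : nat) :
  0 < n -> A \subset X -> #|A| = k -> #|X| = n ->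
  exists2 g : T -> 'I_n, {in X &, injective g} & {in X, forall x, (x \in A) = (g x < k)}.
Proof.
case: n => // n _ AX cA cX; pose s := enum A ++ enum (X :\: A).
have sX x : x \in X -> x \in s.
  by rewrite mem_cat !mem_enum !inE => ->; rewrite andbT orbN.
have ss : size s = n.+1.
  by rewrite size_cat -!cardE cardsD (setIidPr AX) cX subnKC // -cX subset_leq_card.
have gE x : x \in X -> (inord (index x s) : 'I_n.+1) = index x s :> nat.
  by move=> /sX xs; rewrite inordK // -ss index_mem.
exists (fun x => inord (index x s)) => [x y xX yX /(congr1 val) /=|x xX].
  by rewrite !gE // => /(congr1 (nth x s)); rewrite !nth_index ?sX.
rewrite gE // index_cat mem_enum; case: ifP => xA.
  by rewrite -cA cardE index_mem mem_enum.
by rewrite -cardE cA ltnNge leq_addr.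
Qed.

(** Each vertex of [S] has at least [k] neighbours, all within the [k] elements of [Y1], so its
    neighbourhood is exactly [Y1]. *)
Lemma graph_iso_B_graph (T : finType) (e : rel T) (n k : nat) (X S Y1 : {set T}) :
  0 < n -> symmetric e -> bipartition e n X -> in_B_graph e k X S Y1 ->
  (forall v, k <= degree e v) ->
  (forall u v, u \in X :\: S -> v \in ~: X -> e u v) ->
  graph_iso e (@B_graph k n).
Proof.
move=> n0 esym [cX cY eX] [SX Y1Y cS cY1 SY] degk X2Y.
have [g1 g1I g1S] := index_subset_first n0 SX cS cX.
have [g2 g2I g2Y] := index_subset_first n0 Y1Y cY1 cY.
have eS u v : u \in S -> e u v = (v \in Y1).
  move=> uS; suff <- : [set v | e u v] = Y1 by rewrite inE.
  apply/eqP; rewrite eqEcard cY1 degk andbT; apply/subsetP => w.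
  by rewrite inE; apply: SY.
have eXY u v : u \in X -> v \notin X ->
    e u v = ~~ [&& g1 u < k & k <= g2 v].
  move=> uX vX; rewrite -g1S // leqNgt -g2Y ?inE //.
  by have [/eS->|uS] := boolP (u \in S); rewrite ?negbK // X2Y ?inE ?uS.
exists (fun t => if t \in X then inl (g1 t) else inr (g2 t)).
  apply: inj_card_bij => [u v|]; last by rewrite card_sum card_ord -(cardsC X) cX cY.
  have [uX|uX] := boolP (u \in X); have [vX|vX] := boolP (v \in X) => //.
    by move=> [/g1I]; apply.
  by move=> [/g2I]; rewrite !inE; apply.
move=> u v; rewrite /B_graph.
have [uX|uX] := boolP (u \in X); have [vX|vX] := boolP (v \in X) => /=.
- by symmetry; apply/negP => /eX; rewrite uX vX.
- by rewrite eXY.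
- by rewrite esym eXY.
- by symmetry; apply/negP => /eX; rewrite (negPf uX) (negPf vX).
Qed.

(** * Minimum degree and the final dichotomy *)

Lemma min_degree_le (T : finType) (e : rel T) (v : T) : min_degree e <= degree e v.
Proof.
rewrite /min_degree; have : v \in index_enum T by rewrite mem_index_enum.
elim: (index_enum T) => // u s IH; rewrite inE big_cons geq_min => /predU1P[->|/IH->].
  by rewrite leqnn.
by rewrite orbT.
Qed.

Theorem theorem1p7 (R : realType) (k n : nat) (T : finType) (e : rel T)
  (hk : 1 <= k) (hn : k ^ 3 + 2 * k + 4 <= n)
  (he : simple_graph e) (hbip : balanced_bipartite e) (hT : #|T| = 2 * n)
  (hdeg : k <= min_degree e)
  (hlam : (Num.sqrt (n%:R * (n%:R - k%:R)) <= spectral_radius R e)%R) :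
  hamiltonian e \/ graph_iso e (@B_graph k n).
Proof.
have [esym eirr] := he; have [X [Y [XYT XY0 cXY eXY]]] := hbip.
have YE : Y = ~: X.
  apply/setP => t; have := in_setT t; rewrite -XYT !inE.
  by case: (boolP (t \in X)) => [/(disjointFr XY0)->|].
have bipX : bipartition e n X.
  have := cardsC X; rewrite -YE -cXY hT => cX; split; rewrite -?YE -?cXY; [lia|lia|].
  by move=> u v /eXY; rewrite YE !inE; case: (u \in X); case: (v \in X).
have degk v : k <= degree e v := leq_trans hdeg (min_degree_le e v).
have kn : k < n by lia.
have nnk0 : (0 < n%:R * (n%:R - k%:R) :> R)%R.
  by rewrite mulr_gt0 ?subr_gt0 ?ltr_nat ?ltr0n //; lia.
have [|a ca aE] := spectral_radius_ge_eigenvalue _ hlam; first by rewrite sqrtr_gt0.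
have a0 : (0 < a)%R by apply: lt_le_trans ca; rewrite sqrtr_gt0.
have {ca} a2 : (n%:R * (n%:R - k%:R) <= a ^+ 2)%R.
  by rewrite -(sqr_sqrtr (ltW nnk0)) lerXn2r ?nnegrE ?sqrtr_ge0 // ltW.
have edges : n * (n - k) <= \sum_(u in X) degree e u.
  rewrite -(ler_nat R) natrM natrB ?(ltnW kn) //.
  exact: le_trans a2 (eigenvalue_sqr_le_edges esym bipX a0 aE).
have [|[X' [S [Y1 [bipX' inB]]]]] := hamiltonian_or_in_B_graph esym eirr bipX hn degk edges.
  by left.
right; apply: (graph_iso_B_graph _ esym bipX' inB degk) => [|u v uX2 vY]; first by lia.
(* A further missing edge would push [a ^+ 2] strictly below [n (n - k)]. *)
apply/negPn/negP => nuv.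
have := eigenvalue_sqr_lt_in_B_graph esym bipX' inB hk hn uX2 vY nuv a0 aE.
by rewrite ltNge a2.
Qed.
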